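(* Let $\mathbb K\in\{\mathbb R,\mathbb C\}$, let $X\subseteq\mathbb K^n$ be a closed set with $0\in X$, and let $f:\mathbb K^n\to\mathbb R$ be a $C^2$ function. Assume: (i) $\langle\nabla f(0),u\rangle\ge0$ for all $u\in T_0X$; (ii) for every $u\in T_0X\setminus\{0\}$ satisfying $\langle\nabla f(0),u\rangle=0$, one has $$\inf_{w\in T^2_{0,u}X}\Bigl(\langle u,\nabla^2f(0)u\rangle+\langle\nabla f(0),w\rangle\Bigr)>0;$$ (iii) (parabolic regularity at $0$) for every sequence $\{x_k\}\subset X\setminus\{0\}$ with $x_k\to0$ and $\dfrac{f(x_k)-f(0)}{\|x_k\|^2}$ bounded above, there exist, after passing to a subsequence, a nonzero vector $u\in T_0X$, positive numbers $t_k\downarrow0$, and a bounded sequence $\{w_k\}\subseteq\mathbb K^n$ such that $$x_k=t_ku+\tfrac12t_k^2w_k+o(t_k^2),$$ and every cluster point of $\{w_k\}$ belongs to $T^2_{0,u}X$. Then $0$ is a strict local minimizer of $f$ on $X$ and satisfies quadratic growth: there exist $c>0$ and $\varepsilon>0$ such that $$f(x)\ge f(0)+c\|x\|^2\qquad\text{for all }x\in X\cap B_\varepsilon(0).$$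
   Context: $T_0X$ is the set of $v\in\mathbb K^n$ for which there are $x_k\in X\setminus\{0\}$ and real $t_k>0$ with $x_k\to0$ and $t_kx_k\to v$. $T^2_{0,u}X$ is the set of all $w\in\mathbb K^n$ for which there are positive real numbers $t_k\downarrow0$ and $w_k\in\mathbb K^n$ with $w_k\to w$ such that $t_ku+\frac12t_k^2w_k\in X$ for every $k$. $\nabla f(0)$ and $\nabla^2f(0)$ are the gradient and Hessian of $f$ at $0$; $\|\cdot\|$ is the Euclidean norm and $B_\varepsilon(0)$ the ball of radius $\varepsilon$ about $0$. When $\mathbb K=\mathbb C$, $\mathbb K^n$ is identified with $\mathbb R^{2n}$, $f$ is $C^2$ in the real sense, and gradient, Hessian and $\langle\cdot,\cdot\rangle$ are the real Euclidean ones. The infimum over the empty set is $+\infty$. *)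

(* Defs.v *)
From HB Require Import structures.
From mathcomp Require Import all_boot all_order all_algebra.
From mathcomp Require Import all_classical all_reals all_analysis.
From mathcomp Require Import complex.
Set Implicit Arguments.
Unset Strict Implicit.
Unset Printing Implicit Defensive.
Import Order.TTheory GRing.Theory Num.Theory.
Import numFieldNormedType.Exports.

Local Open Scope classical_set_scope.
Local Open Scope ring_scope.
Local Open Scope complex_scope.

Section Calculus.
Context {R : realType} {m : nat}.
Implicit Types (f : 'rV[R]_m -> R) (x y : 'rV[R]_m).

Definition inner x y : R := \sum_(i < m) x 0 i * y 0 i.

Definition gradient f x : 'rV[R]_m :=
  \row_(j < m) 'D_(delta_mx 0 j) f x.

Definition hessian f x : 'M[R]_m :=
  \matrix_(i < m, j < m) 'D_(delta_mx 0 i) ('D_(delta_mx 0 j) f) x.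

Definition C2 f :=
  [/\ forall x, differentiable f x,
      forall x, differentiable (gradient f) x &
      continuous (hessian f)].

End Calculus.

Inductive scalars := RealScalars | ComplexScalars.

Definition scalar_field (R : realType) (k : scalars) : numFieldType :=
  match k with RealScalars => R | ComplexScalars => R[i] end.

Definition real_dim (k : scalars) (n : nat) : nat :=
  match k with RealScalars => n | ComplexScalars => n + n end.

Definition real_scalar (R : realType) (k : scalars) : R -> scalar_field R k :=
  match k with
  | RealScalars => fun t => t
  | ComplexScalars => fun t => t%:C
  end.

(* The identification of C^n with R^(2n): real parts first, then imaginary
   parts. *)
Definition to_real (R : realType) (k : scalars) (n : nat) :
    'rV[scalar_field R k]_n -> 'rV[R]_(real_dim k n) :=
  match k with
  | RealScalars => fun x => x
  | ComplexScalars => fun x : 'rV[R[i]]_n =>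
      row_mx (map_mx (@complex.Re R) x) (map_mx (@complex.Im R) x)
  end.

Definition of_real (R : realType) (k : scalars) (n : nat) :
    'rV[R]_(real_dim k n) -> 'rV[scalar_field R k]_n :=
  match k with
  | RealScalars => fun y => y
  | ComplexScalars => fun y : 'rV[R]_(n + n) =>
      \row_(j < n) (lsubmx y 0 j +i* rsubmx y 0 j)
  end.

Lemma to_realK (R : realType) (k : scalars) (n : nat) :
  cancel (@to_real R k n) (@of_real R k n).
Proof.
case: k => //= x; apply/rowP => j; rewrite mxE row_mxKl row_mxKr !mxE.
by case: (x 0 j).
Qed.

Lemma of_realK (R : realType) (k : scalars) (n : nat) :
  cancel (@of_real R k n) (@to_real R k n).
Proof.
case: k => //= y; rewrite -[RHS]hsubmxK.
by congr row_mx; apply/rowP => j; rewrite !mxE.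
Qed.

Section Cones.
Context {R : realType} {k : scalars} {n : nat}.
Notation Kn := 'rV[scalar_field R k]_n.
Implicit Types (X : set Kn) (f : Kn -> R) (u v w x : Kn).

Definition rscale (t : R) v : Kn := real_scalar k t *: v.

Definition rdot v w : R := inner (to_real v) (to_real w).

(* The library norm `|x| on row vectors is the sup norm, hence this one. *)
Definition enorm v : R := Num.sqrt (rdot v v).

Definition real_C2 f := C2 (f \o @of_real R k n).

(* Real derivatives, taken in real coordinates: for complex scalars the j-th
   entry of grad f x is df/d(Re z_j) + i df/d(Im z_j). *)
Definition grad f x : Kn :=
  of_real (gradient (f \o @of_real R k n) (to_real x)).

(* Row i of the Hessian matrix is the derivative of the gradient along the
   i-th basis vector, so multiplying on the right applies it to u. *)
Definition hess f x u : Kn :=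
  of_real (to_real u *m hessian (f \o @of_real R k n) (to_real x)).

Definition tangent_cone X : set Kn :=
  [set v | exists (x : nat -> Kn) (t : nat -> R),
    [/\ forall i, X (x i) /\ x i != 0,
        forall i, 0 < t i,
        x @ \oo --> (0 : Kn) &
        (fun i => rscale (t i) (x i)) @ \oo --> v]].

Definition tangent_set2 X u : set Kn :=
  [set w | exists (t : nat -> R) (w_ : nat -> Kn),
    [/\ forall i, 0 < t i,
        t @ \oo --> (0 : R),
        w_ @ \oo --> w &
        forall i, X (rscale (t i) u + rscale (2^-1 * t i ^+ 2) (w_ i))]].

Definition parabolically_regular X f :=
  forall x : nat -> Kn,
    (forall i, X (x i) /\ x i != 0) ->
    x @ \oo --> (0 : Kn) ->
    has_ubound (range (fun i => (f (x i) - f 0) / enorm (x i) ^+ 2)) ->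
    exists (phi : nat -> nat) (u : Kn) (t : nat -> R) (w : nat -> Kn),
      [/\ {homo phi : i j / (i < j)%N},
          tangent_cone X u /\ u != 0,
          (forall i, 0 < t i) /\ t @ \oo --> (0 : R),
          has_ubound (range (fun i => enorm (w i))) &
          (fun i => enorm (x (phi i)
              - (rscale (t i) u + rscale (2^-1 * t i ^+ 2) (w i))))
            =o_\oo (fun i => t i ^+ 2) /\
          cluster (w @ \oo) `<=` tangent_set2 X u].

Definition strict_local_minimizer X f :=
  X 0 /\ \forall x \near (0 : Kn), X x -> x != 0 -> f 0 < f x.

End Cones.

(* Main.v *)
(* Suppose growth fails along x_k in X, x_k -> 0, with f(x_k) - f(0) <
   |x_k|^2 / (k+1).  Parabolic regularity puts (a subsequence of) the x_k on
   parabolas t_k u + t_k^2 w_k / 2 up to o(t_k^2), and the bounded w_k have a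
   cluster point w0 in the second-order tangent set.  By the second-order
   Taylor formula, f(t u + t^2 w / 2) - f(0) is
     t <g, u> + t^2 / 2 (<u, H u> + <g, w0>) + o(t^2)
   as t -> 0+ and w -> w0.  Either <g, u> > 0, or <g, u> = 0 and the t^2
   coefficient is positive; both ways the increment is at least a fixed
   multiple of t^2, hence of |x_k|^2, for infinitely many k.  The o(t_k^2)
   error is absorbed by perturbing w_k. *)
Require Import Defs.
From mathcomp Require Import all_boot all_order all_algebra.
From mathcomp Require Import all_classical all_reals all_analysis.
From mathcomp Require Import complex ring lra.
Import Order.TTheory GRing.Theory Num.Theory.
Import numFieldNormedType.Exports.
Local Open Scope classical_set_scope.
Local Open Scope ring_scope.

(** * Euclidean inner product against the sup norm *)

Section Inner.
Context {R : realType} {m : nat}.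
Implicit Types (x y z : 'rV[R]_m) (a : R).

Lemma innerDr x y z : inner x (y + z) = inner x y + inner x z.
Proof. by rewrite -big_split; apply: eq_bigr => i _; rewrite mxE mulrDr. Qed.

Lemma innerZr a x y : inner x (a *: y) = a * inner x y.
Proof. by rewrite mulr_sumr; apply: eq_bigr => i _; rewrite mxE; ring. Qed.

Lemma innerC x y : inner x y = inner y x.
Proof. by apply: eq_bigr => i _; rewrite mulrC. Qed.

Lemma innerDl x y z : inner (x + y) z = inner x z + inner y z.
Proof. by rewrite innerC innerDr !(innerC z). Qed.

Lemma innerZl a x y : inner (a *: x) y = a * inner x y.
Proof. by rewrite innerC innerZr innerC. Qed.

Lemma innerNl x y : inner (- x) y = - inner x y.
Proof. by rewrite -scaleN1r innerZl mulN1r. Qed.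

Lemma inner0l x : inner 0 x = 0.
Proof. by rewrite -(scale0r 0) innerZl mul0r. Qed.

Lemma inner_ge0 x : 0 <= inner x x.
Proof. by apply: sumr_ge0 => i _; rewrite -expr2 sqr_ge0. Qed.

Lemma le_coord_norm x i : `|x 0 i| <= `|x|.
Proof.
by rewrite [leRHS]mx_normrE; apply: (le_bigmax _ _ (0 : 'I_1, i)).
Qed.

Lemma coord_sqr_le_inner x i : x 0 i ^+ 2 <= inner x x.
Proof.
rewrite /inner (bigD1 i)//= expr2 lerDl.
by apply: sumr_ge0 => j _; rewrite -expr2 sqr_ge0.
Qed.

Lemma norm_le_sqrt_inner x : `|x| <= Num.sqrt (inner x x).
Proof.
rewrite [leLHS]mx_normrE; apply: bigmax_le => [|[i j] _]; first exact: sqrtr_ge0.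
by rewrite (ord1 i)/= -sqrtr_sqr ler_sqrt ?inner_ge0// coord_sqr_le_inner.
Qed.

Lemma norm_sqr_le_inner x : `|x| ^+ 2 <= inner x x.
Proof.
rewrite -(sqr_sqrtr (inner_ge0 x)) lerXn2r ?nnegrE ?sqrtr_ge0//.
exact: norm_le_sqrt_inner.
Qed.

(** Cauchy-Schwarz adapted to the sup norm: each of the [m] products is at most [|x| * |y|], whence
    the factor [m]. *)
Lemma ler_inner_norm x y : `|inner x y| <= m%:R * (`|x| * `|y|).
Proof.
apply: (le_trans (ler_norm_sum _ _ _)).
rewrite -[m in m%:R]card_ord -sum1_card natr_sum mulr_suml.
by apply: ler_sum => i _; rewrite mul1r normrM ler_pM// le_coord_norm.
Qed.

Lemma cvg_inner {T : Type} {F : set_system T} {FF : Filter F}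
    (u v : T -> 'rV[R]_m) x y :
  u @ F --> x -> v @ F --> y -> inner (u t) (v t) @[t --> F] --> inner x y.
Proof.
move=> ux vy.
have C (M : 'rV[R]_m) i : N 0 i @[N --> M] --> M 0 i by exact: coord_continuous.
apply: cvg_big => [|i _]; first exact: add_continuous.
apply: cvgM.
  exact: cvg_comp ux (C _ _).
exact: cvg_comp vy (C _ _).
Qed.

End Inner.

(** * Second-order Taylor formula with Peano remainder *)

Section Taylor.
Context {R : realType} {m : nat}.
Implicit Types (f : 'rV[R]_m -> R) (x y : 'rV[R]_m).

Lemma diff_gradient f x y :
  differentiable f x -> 'd f x y = inner (gradient f x) y.
Proof.
move=> df; rewrite {1}(row_sum_delta y) linear_sum; apply: eq_bigr => i _.
by rewrite linearZ/= -deriveE// mxE mulrC.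
Qed.

(** The j-th coordinate of the gradient is ['D_(delta_mx 0 j) f], so the Hessian is the Jacobian of
    the gradient in the row-vector convention. *)
Lemma diff_gradient_hessian f x y :
  differentiable (gradient f) x -> 'd (gradient f) x y = y *m hessian f x.
Proof.
move=> dg; rewrite -deriveE// deriveEjacobian//; congr (_ *m _).
apply/matrixP => i j; rewrite mxE.
have E : 'D_(delta_mx 0 j) f = (fun z => gradient f z 0 j).
  by apply/funext => z; rewrite mxE.
rewrite [RHS]mxE E -deriveE// derive_mx; last exact: diff_derivable.
by rewrite mxE.
Qed.

Lemma is_derive_line f x y (s : R) : derivable f (x + s *: y) y ->
  is_derive s 1 (fun t => f (x + t *: y)) ('D_y f (x + s *: y)).
Proof.
have E : (fun h : R => h^-1 *: (f (x + (h *: 1 + s) *: y) - f (x + s *: y))) =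
  (fun h : R => h^-1 *: (f (h *: y + (x + s *: y)) - f (x + s *: y))).
  apply/funext => h; congr (_ *: (f _ - _)).
  by rewrite scalerDl [h *: 1]mulr1 addrCA.
by move=> df; apply: DeriveDef; rewrite /derivable /derive/= E.
Qed.

(** The remainder equals the first-order error of the gradient at some [c *: y] with 0 < c < 1,
    paired with [y]. That error is o(|y|), so the pairing is o(|y|^2). *)
Lemma taylor2 f x : (forall y, differentiable f y) ->
  differentiable (gradient f) x -> forall eps : R, 0 < eps ->
  \forall y \near (0 : 'rV[R]_m),
    `|f (x + y) - f x - inner (gradient f x) y
      - 2^-1 * inner y (y *m hessian f x)| <= eps * `|y| ^+ 2.
Proof.
move=> df dg eps eps0; set g := gradient f x; set H := hessian f x.
(* Dividing pays for the factor [m] of [ler_inner_norm]; the [+ 1] covers m = 0. *)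
pose d := eps / (m%:R + 1).
have d0 : 0 < d by rewrite divr_gt0// ltr_wpDl.
have /eqaddoP/(_ d d0) := diff_locally dg.
move=> /nbhs_ballP[r r0 rP]; apply/nbhs_ballP; exists r => // y yr.
(* The mean value theorem for the second-order remainder psi along [x, x + y]
   only needs the gradient to be differentiable at x itself. *)
pose psi (s : R) := f (x + s *: y) - s * inner g y
  - s ^+ 2 * (2^-1 * inner y (y *m H)).
pose dpsi (s : R) := inner (gradient f (x + s *: y) - g - s *: (y *m H)) y.
have dpsiP (s : R) : is_derive s (1 : R) psi (dpsi s).
  have := is_derive_line f x y s (diff_derivable (df (x + s *: y))).
  rewrite deriveE// diff_gradient// => Dl.
  have -> : dpsi s = inner (gradient f (x + s *: y)) y
      - inner g y - 2 * s * (2^-1 * inner y (y *m H)).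
    by rewrite /dpsi !innerDl !innerNl innerZl (innerC y); field.
  have D1 (a : R) : is_derive s (1 : R) (fun t : R => t * a) a.
    by apply: is_derive_eq; rewrite /GRing.scale/=; ring.
  have D2 (a : R) : is_derive s (1 : R) (fun t : R => t ^+ 2 * a) (2 * s * a).
    by apply: is_derive_eq; rewrite /GRing.scale/=; ring.
  exact: is_deriveB.
have psic : {within `[0, 1], continuous psi}.
  apply: continuous_subspaceT => s; apply: differentiable_continuous.
  exact/derivable1_diffP.
have [c /[!in_itv]/= /andP[c0 c1]] := MVT ltr01 (fun s _ => dpsiP s) psic.
rewrite subr0 mulr1 /psi scale0r addr0 scale1r expr0n expr1n !mul0r !subr0 !mul1r.
move=> E.
have -> : f (x + y) - f x - inner g y - 2^-1 * inner y (y *m H) = dpsi c.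
  by rewrite -E; ring.
apply: (le_trans (ler_inner_norm _ _)).
have cy : `|c *: y| = c * `|y| by rewrite normrZ gtr0_norm.
have /rP/= : ball (0 : 'rV[R]_m) r (c *: y).
  move: yr; rewrite -!ball_normE/= !sub0r !normrN cy; apply: le_lt_trans.
  by rewrite ler_piMl// ltW.
rewrite -[X in `|X|]/(gradient f (c *: y + x) - (g + 'd (gradient f) x (c *: y))).
rewrite diff_gradient_hessian// -scalemxAl (addrC _ x) opprD addrA cy => le_dpsi.
apply: (@le_trans _ _ (m%:R * (d * `|y| * `|y|))).
  rewrite ler_wpM2l// ler_wpM2r//; apply: (le_trans le_dpsi).
  by rewrite ler_pM2l// ler_piMl// ltW.
have -> : m%:R * (d * `|y| * `|y|) = m%:R * d * `|y| ^+ 2 by ring.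
rewrite ler_wpM2r ?sqr_ge0// /d mulrA ler_pdivrMr ?ltr_wpDl//.
by rewrite mulrC ler_pM2l// lerDl.
Qed.

End Taylor.

(** * Growth of a function along parabolas *)

Section Parabola.
Context {R : realType} {m : nat}.
Implicit Types (f : 'rV[R]_m -> R) (x y u v w : 'rV[R]_m) (t : R).

Definition parabola u t w := t *: u + (2^-1 * t ^+ 2) *: w.

(** Factoring out [t] leaves a velocity close to [u], so the squared length of the point is
    comparable to t^2. *)
Lemma parabolaE u t w : parabola u t w = t *: (u + (2^-1 * t) *: w).
Proof. by rewrite /parabola scalerDr scalerA; congr (_ + _ *: _); ring. Qed.

(** The filter is left general to serve both [0^'+] and the full neighbourhoods of 0. *)
Lemma cvg_parabola_velocity (F : set_system R) u w0 : Filter F -> F --> 0 ->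
  u + (2^-1 * p.1) *: p.2 @[p --> (F, nbhs w0)] --> u.
Proof.
move=> FF F0; rewrite -[X in _ --> X]addr0 -(scale0r w0) -(mulr0 2^-1).
apply: cvgD; [exact: cvg_cst|apply: cvgZ; last exact: cvg_snd].
by apply: cvgM; [exact: cvg_cst|exact: cvg_trans cvg_fst F0].
Qed.

(** With v = u + (t/2) w, Taylor at t v gives t <g, u> + t^2/2 (<v, H v> + <g, w>) up to o(t^2
    |v|^2). As v tends to u and w to [w0], the t^2 coefficient converges. *)
Lemma parabolic_lower_bound f x u w0 (e : R) :
  (forall y, differentiable f y) -> differentiable (gradient f) x -> 0 < e ->
  \forall p \near (0^'+, nbhs w0),
    p.1 * inner (gradient f x) u + p.1 ^+ 2 *
    (2^-1 * (inner u (u *m hessian f x) + inner (gradient f x) w0) - e)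
    <= f (x + parabola u p.1 p.2) - f x.
Proof.
move=> df dg e0; set g := gradient f x; set H := hessian f x.
pose F : set_system (R * 'rV[R]_m) := filter_prod 0^'+ (nbhs w0).
have FF : ProperFilter F by exact: filter_prod_proper.
have F0 : (0 : R)^'+ --> (0 : R) by exact: cvg_within.
have tF : p.1 @[p --> F] --> (0 : R) by exact: cvg_trans cvg_fst F0.
have wF : p.2 @[p --> F] --> w0 by exact: cvg_snd.
pose v (p : R * 'rV[R]_m) := u + (2^-1 * p.1) *: p.2.
have vF : v @ F --> u by exact: (cvg_parabola_velocity _ u w0 _ F0).
have yF : p.1 *: v p @[p --> F] --> (0 : 'rV[R]_m).
  by rewrite -(scale0r u); exact: cvgZ.
have vHF : v p *m H @[p --> F] --> u *m H.
  have -> : (fun p => v p *m H) = 'd (gradient f) x \o v.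
    by apply/funext => p /=; rewrite diff_gradient_hessian.
  rewrite -diff_gradient_hessian//.
  by apply: cvg_comp vF _; exact: diff_continuous.
have AF : 2^-1 * (inner (v p) (v p *m H) + inner g p.2) @[p --> F] -->
    2^-1 * (inner u (u *m H) + inner g w0).
  apply: cvgM; first exact: cvg_cst.
  by apply: cvgD; apply: cvg_inner => //; exact: cvg_cst.
set L := 2^-1 * _ in AF *.
(* [M] eventually bounds |v|^2, so Taylor with precision [e / 2 / M] costs at most e/2 t^2. The
   other e/2 pays for replacing the t^2 coefficient by its limit [L]. *)
pose M := inner u u + 1.
have M0 : 0 < M by rewrite ltr_wpDl// inner_ge0.
have MF : \forall p \near F, inner (v p) (v p) < M.
  by apply: (cvgr_lt (inner u u)); [exact: cvg_inner|rewrite ltrDl].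
have eM0 : 0 < e / 2 / M by rewrite !divr_gt0.
have TF := yF _ (taylor2 f x df dg _ eM0).
have LF : \forall p \near F,
    L - e / 2 < 2^-1 * (inner (v p) (v p *m H) + inner g p.2).
  by apply: (cvgr_gt L) => //; rewrite gtrBl divr_gt0.
near=> p.
rewrite parabolaE -/(v p).
have : `|f (x + p.1 *: v p) - f x - inner g (p.1 *: v p) -
   2^-1 * inner (p.1 *: v p) (p.1 *: v p *m H)| <= e / 2 / M * `|p.1 *: v p| ^+ 2.
  by near: p; exact: TF.
have p2 : p.1 ^+ 2 * L <=
    p.1 ^+ 2 * (2^-1 * (inner (v p) (v p *m H) + inner g p.2) + e / 2).
  by rewrite ler_wpM2l ?sqr_ge0// -lerBlDr ltW//; near: p; exact: LF.
have pM : e / 2 / M * `|p.1 *: v p| ^+ 2 <= p.1 ^+ 2 * (e / 2).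
  rewrite normrZ exprMn real_normK ?num_real// mulrCA ler_wpM2l ?sqr_ge0//.
  rewrite mulrAC ler_pdivrMr// ler_pM2l ?divr_gt0//.
  rewrite (le_trans (norm_sqr_le_inner _))// ltW//; near: p; exact: MF.
rewrite ler_norml => /andP[+ _].
rewrite -scalemxAl !innerZr innerZl /v innerDr innerZr.
move: pM p2; rewrite /v; nra.
Unshelve. all: by end_near. Qed.

Lemma parabolic_growth f x u w0 :
  (forall y, differentiable f y) -> differentiable (gradient f) x ->
  0 <= inner (gradient f x) u ->
  (inner (gradient f x) u = 0 ->
    0 < inner u (u *m hessian f x) + inner (gradient f x) w0) ->
  exists2 c, 0 < c & \forall p \near (0^'+, nbhs w0),
    c * p.1 ^+ 2 <= f (x + parabola u p.1 p.2) - f x.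
Proof.
move=> df dg gu0 guL.
pose F : set_system (R * 'rV[R]_m) := filter_prod 0^'+ (nbhs w0).
have FF : ProperFilter F by exact: filter_prod_proper.
set g := gradient f x in gu0 guL *; set H := hessian f x in guL *.
have [gu|gu] := eqVneq (inner g u) 0.
  set L := inner u (u *m H) + inner g w0 in guL.
  (* The coefficient L/2 minus a tolerance of L/4 leaves L/4. *)
  have L0 : 0 < 4^-1 * L by rewrite mulr_gt0 ?guL// invr_gt0.
  exists (4^-1 * L) => //.
  apply: filterS (parabolic_lower_bound f x u w0 _ df dg L0) => p.
  by apply: le_trans; rewrite -/g -/H -/L gu; lra.
have {gu0 gu} gu : 0 < inner g u by rewrite lt_def gu.
set L := inner u (u *m H) + inner g w0 in guL.
have tF : p.1 @[p --> F] --> (0 : R).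
  by apply: cvg_trans cvg_fst _; exact: cvg_within.
have t0F : \forall p \near F, 0 < p.1.
  by exists ([set t : R | 0 < t], setT) => [|p []//]; split;
    [exact: nbhs_right_gt|exact: filterT].
(* For small t the linear term dominates: t <g, u> >= t^2 (2 - L/2). Adding t^2 (L/2 - 1), the lower
   bound with tolerance 1, gives t^2, whatever the sign of L. *)
have lF : \forall p \near F, p.1 * (2 - 2^-1 * L) < inner g u.
  apply: (cvgr_lt 0) => //; rewrite -[X in _ --> X](mul0r (2 - 2^-1 * L)).
  by apply: cvgM => //; exact: cvg_cst.
exists 1 => //.
apply: filterS3 lF t0F (parabolic_lower_bound f x u w0 1 df dg ltr01) => p lp p0.
apply: le_trans; rewrite -/g -/H -/L.
by have := ltW lp; rewrite -(ler_pM2l p0); nra.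
Qed.

(** The growth holds for infinitely many indices, because [w] comes near its cluster point only
    infinitely often; hence the quantification over eventual sets [A]. *)
Lemma parabolic_sequence_growth f x u w0 (y w : nat -> 'rV[R]_m) (t : nat -> R) :
  (forall y, differentiable f y) -> differentiable (gradient f) x ->
  0 <= inner (gradient f x) u ->
  (inner (gradient f x) u = 0 ->
    0 < inner u (u *m hessian f x) + inner (gradient f x) w0) ->
  (forall i, 0 < t i) -> t @ \oo --> 0 ->
  (forall e : R, 0 < e ->
     \forall i \near \oo, `|y i - parabola u (t i) (w i)| <= e * t i ^+ 2) ->
  cluster (w @ \oo) w0 ->
  exists2 c, 0 < c & forall A : set nat, (\oo) A ->
    exists2 i, A i & c * inner (y i) (y i) <= f (x + y i) - f x.
Proof.
move=> df dg gu0 guL t0 tlim yo clw.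
have [c c0 [[P Q] [/= P0 Qw] PQ]] := parabolic_growth f x u w0 df dg gu0 guL.
pose F : set_system (R * 'rV[R]_m) := filter_prod (nbhs (0 : R)) (nbhs w0).
have FF : ProperFilter F by exact: filter_prod_proper.
pose v (p : R * 'rV[R]_m) := u + (2^-1 * p.1) *: p.2.
have vF : v @ F --> u.
  exact: (cvg_parabola_velocity _ u w0 (nbhs_filter _) cvg_id).
have vP : \forall p \near F, inner (v p) (v p) < inner u u + 1.
  by apply: (cvgr_lt (inner u u)); [exact: cvg_inner|rewrite ltrDl].
case: vP => -[P' Q'] [/= P'0 Q'w] P'Q'.
have M0 : 0 < inner u u + 1 by rewrite ltr_wpDl// inner_ge0.
(* Since |y_i|^2 = t_i^2 |v|^2 <= t_i^2 (|u|^2 + 1), this constant turns growth in t_i^2 into growth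
   in |y_i|^2. *)
exists (c / (inner u u + 1)); first by rewrite divr_gt0.
have /nbhs_ballP[r /= r0 rQ] : nbhs w0 (Q `&` Q') by exact: filterI.
have r4 : 0 < r / 4 by rewrite divr_gt0.
move=> A oA.
(* All eventual conditions are gathered first, so that the one index supplied by the cluster point
   meets them together. *)
pose good i := [/\ A i, P (t i), P' (t i) &
  `|y i - parabola u (t i) (w i)| <= r / 4 * t i ^+ 2].
have oG : (\oo) good.
  (* [P] is only a right neighbourhood of 0; the positivity of [t i] closes the gap. *)
  have oP : (\oo) (P \o t) by apply: (@filterS _ \oo _ _ _ _ (tlim _ P0)) => i; exact.
  have oP' : (\oo) (P' \o t) by exact: tlim.
  apply: filterS (filterI (filterI oA oP) (filterI oP' (yo _ r4))) => i.
  by move=> [[? ?] [? ?]].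
have wG : (w @ \oo) (w @` good) by apply: filterS oG => i; exists i.
have r2 : 0 < r / 2 by rewrite divr_gt0.
have [_ [[i [Ai Pi P'i yi] <-] wi]] := clw _ _ wG (nbhsx_ballx w0 _ r2).
exists i => //.
(* [w'] puts [y i] exactly on a parabola. It differs from [w i] by 2 / t_i^2 times the error, hence
   by at most r/2, which is why the tolerance was r/4. *)
pose w' := w i + (2 / t i ^+ 2) *: (y i - parabola u (t i) (w i)).
have yE : y i = parabola u (t i) w'.
  rewrite /w' /parabola scalerDr scalerA addrA.
  have -> : 2^-1 * t i ^+ 2 * (2 / t i ^+ 2) = 1 by field; rewrite gt_eqF.
  by rewrite scale1r [RHS]addrC subrK.
have w'r : ball w0 r w'.
  move: wi; rewrite -!ball_normE/= => wi.
  rewrite /w' opprD addrA (le_lt_trans (ler_normB _ _))// (splitr r) ltr_leD//.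
  rewrite normrZ gtr0_norm ?divr_gt0 ?exprn_gt0// mulrAC ler_pdivrMr ?exprn_gt0//.
  by move: yi; lra.
have [Qi Q'i] := rQ _ w'r.
have := P'Q' (t i, w') (conj P'i Q'i); rewrite /= => vM.
have := PQ (t i, w') (conj Pi Qi); rewrite /= -yE; apply: le_trans.
rewrite {1 2}yE parabolaE innerZl innerZr.
set V := inner _ _ in vM *.
rewrite mulrAC ler_pdivrMr// -mulrA ler_pM2l// mulrA -expr2 ler_wpM2l ?sqr_ge0//.
exact: ltW.
Qed.

End Parabola.

(** * Continuity and real linearity of the passage to real coordinates *)

Section RealCoordinates.
Local Open Scope complex_scope.
Context {R : realType}.
Notation C := (R[i] : numFieldType).

(** A neighbourhood of a matrix contains a finite product of neighbourhoods of its entries. *)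
Lemma continuous_mx {K T : topologicalType} {m n : nat} (u : T -> 'M[K]_(m, n)) :
  (forall i j, continuous (fun t => u t i j)) -> continuous u.
Proof.
move=> uC x B [P PA PB].
suff : nbhs x [set t | forall i j, P i j (u t i j)].
  by apply: filterS => t ?; exact: PB.
by apply: filter_forall => i; apply: filter_forall => j; exact: uC (PA i j).
Qed.

Lemma normc_i : `|'i : R[i]| = 1.
Proof. by rewrite normc_def/= expr0n add0r expr1n sqrtr1. Qed.

Lemma normc_ge_Im (z : R[i]) : `|complex.Im z|%:C <= `|z|.
Proof.
have -> : complex.Im z = - complex.Re ('i * z) by case: z => a b /=; ring.
by rewrite normrN (le_trans (normc_ge_Re _))// normrM normc_i mul1r.
Qed.

Lemma normc_le_ReDIm (z : R[i]) :
  `|z| <= (`|complex.Re z| + `|complex.Im z|)%:C.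
Proof.
rewrite {1}[z]complexE (le_trans (ler_normD _ _))// normrM normc_i mul1r.
by rewrite rmorphD/= !normc_def/= !expr0n !addr0 !sqrtr_sqr.
Qed.

Lemma Re_continuous : continuous (fun z : C => complex.Re z : R).
Proof.
move=> z A /nbhs_ballP[e /= e0 eA]; apply/nbhs_ballP.
exists e%:C; first by rewrite /= ltcR.
move=> z' zz'; apply: eA; suff : `|complex.Re z - complex.Re z'| < e by [].
have {}zz' : `|z - z'| < e%:C by [].
by rewrite -ltcR -raddfB (le_lt_trans (normc_ge_Re _)).
Qed.

Lemma Im_continuous : continuous (fun z : C => complex.Im z : R).
Proof.
move=> z A /nbhs_ballP[e /= e0 eA]; apply/nbhs_ballP.
exists e%:C; first by rewrite /= ltcR.
move=> z' zz'; apply: eA; suff : `|complex.Im z - complex.Im z'| < e by [].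
have {}zz' : `|z - z'| < e%:C by [].
by rewrite -ltcR -raddfB (le_lt_trans (normc_ge_Im _)).
Qed.

Lemma cvg_complex {T : Type} {F : set_system T} {FF : Filter F} (a b : T -> R) x y :
  a @ F --> x -> b @ F --> y -> (fun t => a t +i* b t : C) @ F --> (x +i* y : C).
Proof.
move=> ax bY A /nbhs_ballP[e /= e0 eA].
(* Radii of balls in [C] are themselves complex; a positive one is real, so its real part serves as
   a radius in [R]. *)
have eE : (complex.Re e)%:C = e by exact/RRe_real/gtr0_real.
have e20 : 0 < complex.Re e / 2 by rewrite divr_gt0// -ltcR eE.
have /cvgrPdist_lt/(_ _ e20) ax' := ax; have /cvgrPdist_lt/(_ _ e20) bY' := bY.
suff : F [set t | A (a t +i* b t)] by [].
apply: filterS2 ax' bY' => t xt yt; apply: eA.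
suff : `|(x +i* y) - (a t +i* b t)| < e by [].
rewrite (le_lt_trans (normc_le_ReDIm _))// -eE ltcR/=.
by rewrite (splitr (complex.Re e)) ltrD.
Qed.

Lemma to_real_continuous (k : scalars) (n : nat) : continuous (@to_real R k n).
Proof.
case: k; first by move=> x; exact: cvg_id.
suff : continuous (fun x : 'rV[C]_n => row_mx (map_mx (@complex.Re R) x)
    (map_mx (@complex.Im R) x)) by [].
apply: continuous_mx => i j; rewrite (ord1 i) => x.
have cC l : (y : 'rV[C]_n) 0 l @[y --> x] --> x 0 l by exact: coord_continuous.
case: (split_ordP j) => l ->.
  have -> : (fun y : 'rV[C]_n => row_mx (map_mx (@complex.Re R) y)
    (map_mx (@complex.Im R) y) 0 (lshift n l)) = (fun y => complex.Re (y 0 l)).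
    by apply/funext => y; rewrite row_mxEl mxE.
  exact: cvg_comp (cC l) (Re_continuous _).
have -> : (fun y : 'rV[C]_n => row_mx (map_mx (@complex.Re R) y)
  (map_mx (@complex.Im R) y) 0 (rshift n l)) = (fun y => complex.Im (y 0 l)).
  by apply/funext => y; rewrite row_mxEr mxE.
exact: cvg_comp (cC l) (Im_continuous _).
Qed.

Lemma of_real_continuous (k : scalars) (n : nat) : continuous (@of_real R k n).
Proof.
case: k; first by move=> y; exact: cvg_id.
suff : continuous (fun y : 'rV[R]_(n + n) =>
    \row_j (lsubmx y 0 j +i* rsubmx y 0 j) : 'rV[C]_n) by [].
apply: continuous_mx => i j y.
have -> : (fun t : 'rV[R]_(n + n) => (\row_j (lsubmx t 0 j +i* rsubmx t 0 j)) i j)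
  = (fun t => t 0 (lshift n j) +i* t 0 (rshift n j)).
  by apply/funext => z; rewrite !mxE.
have cC l : (z : 'rV[R]_(n + n)) 0 l @[z --> y] --> y 0 l by exact: coord_continuous.
exact: (cvg_complex _ _ _ _ (cC _) (cC _)).
Qed.

Context {k : scalars} {n : nat}.
Notation Kn := 'rV[scalar_field R k]_n.

Lemma to_realD (x y : Kn) : to_real (x + y) = to_real x + to_real y.
Proof.
case: k x y => //= x y; rewrite add_row_mx; congr row_mx;
 by apply/rowP => j; rewrite !mxE raddfD.
Qed.

Lemma to_real_rscale (t : R) (x : Kn) : to_real (rscale t x) = t *: to_real x.
Proof.
case: k x => //= x; rewrite scale_row_mx; congr row_mx; apply/rowP => j;
  by rewrite !mxE; case: (x 0 j) => a b /=; ring.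
Qed.

End RealCoordinates.

(** * The Euclidean norm and compactness, read in real coordinates *)

Section Transfer.
Context {R : realType} {k : scalars} {n : nat}.
Notation Kn := 'rV[scalar_field R k]_n.
Implicit Types x u w : Kn.

Lemma to_real0 : to_real (0 : Kn) = 0.
Proof. by apply: (addrI (to_real (0 : Kn))); rewrite -to_realD !addr0. Qed.

Lemma to_realN x : to_real (- x) = - to_real x.
Proof.
by apply: (addrI (to_real x)); rewrite -to_realD !subrr to_real0.
Qed.

Lemma to_real_parabola u (t : R) w :
  to_real (rscale t u + rscale (2^-1 * t ^+ 2) w)
  = parabola (to_real u) t (to_real w).
Proof. by rewrite to_realD !to_real_rscale. Qed.

Lemma enorm_ge0 x : 0 <= enorm x.
Proof. exact: sqrtr_ge0. Qed.

Lemma enorm_sqr x : enorm x ^+ 2 = inner (to_real x) (to_real x).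
Proof. by rewrite sqr_sqrtr// inner_ge0. Qed.

Lemma norm_to_real_le_enorm x : `|to_real x| <= enorm x.
Proof. exact: norm_le_sqrt_inner. Qed.

Lemma enorm_gt0 x : x != 0 -> 0 < enorm x.
Proof.
move=> x0; apply: lt_le_trans (norm_to_real_le_enorm x); rewrite normr_gt0.
by apply: contra_neq x0 => x0; rewrite -(to_realK x) x0 -to_real0 to_realK.
Qed.

Lemma near_enorm_lt (e : R) : 0 < e -> \forall x \near (0 : Kn), enorm x < e.
Proof.
move=> e0; have C := @to_real_continuous R k n 0.
have := cvg_inner (FF := nbhs_filter _) _ _ _ _ C C; rewrite to_real0 inner0l.
move=> CC; have := cvgr_lt (FF := nbhs_filter _) _ CC _ (exprn_gt0 2 e0).
apply: filterS => x.
by rewrite -enorm_sqr ltr_pXn2r// nnegrE ?enorm_ge0 ?ltW.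
Qed.

Lemma cvg_enorm0 (x : nat -> Kn) :
  (forall i, enorm (x i) < i.+1%:R^-1) -> x @ \oo --> (0 : Kn).
Proof.
move=> x0; have tx0 : to_real (x i) @[i --> \oo] --> to_real (0 : Kn).
  rewrite to_real0; apply/cvgr0Pnorm_lt => e e0; near=> i.
  apply: le_lt_trans (norm_to_real_le_enorm _) _.
  apply: lt_trans (x0 i) _.
  near: i; exact: (near_infty_natSinv_lt (PosNum e0)).
have -> : x = (fun i => of_real (to_real (x i))).
  by apply/funext => i; rewrite to_realK.
rewrite -[X in _ --> X]to_realK.
exact: cvg_comp tx0 (@of_real_continuous R k n _).
Unshelve. all: by end_near. Qed.

(** Heine-Borel in real coordinates, carried back by continuity of [of_real]. The cluster point in
    K^n feeds parabolic regularity, its real form the growth estimate. *)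
Lemma bounded_enorm_cluster (w : nat -> Kn) :
  has_ubound (range (fun i => enorm (w i))) ->
  exists w0 : Kn, cluster (w @ \oo) w0 /\
    cluster (to_real (w i) @[i --> \oo]) (to_real w0).
Proof.
move=> [B wB].
pose A : set 'rV[R]_(real_dim k n) := [set y | `|y| <= B].
have cA : compact A.
  apply: bounded_closed_compact.
    exists B; split; rewrite ?num_real// => M BM y /= /le_trans; apply.
    exact: ltW.
  exact: (closed_comp (fun y _ => @norm_continuous _ _ y) (@closed_le _ B)).
have wA : (to_real (w i) @[i --> \oo]) A.
  exists 0%N => // i _; apply: le_trans (norm_to_real_le_enorm _) _.
  by apply: wB; exists i.
have [y [_ yw]] := cA _ _ wA.
exists (of_real y); split; last by rewrite of_realK.
move=> P Q wP /(@of_real_continuous R k n) Qy.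
have wP' : (to_real (w i) @[i --> \oo]) [set z | P (of_real z)].
  by apply: (@filterS _ \oo _ _ _ _ wP) => i /= Pi; rewrite to_realK.
by have [z [Pz Qz]] := yw _ _ wP' Qy; exists (of_real z).
Qed.

End Transfer.

(** * Quadratic growth by contradiction, and strict minimality *)

Lemma quadratic_growth (R : realType) (k : scalars) (n : nat)
    (X : set 'rV[scalar_field R k]_n) (f : 'rV[scalar_field R k]_n -> R)
    (fC2 : real_C2 f)
    (first_order : forall u, tangent_cone X u -> 0 <= rdot (grad f 0) u)
    (second_order : forall u, tangent_cone X u -> u != 0 ->
       rdot (grad f 0) u = 0 ->
       (0 < ereal_inf [set (rdot u (hess f 0 u) + rdot (grad f 0) w)%:E
                        | w in tangent_set2 X u])%E)
    (regular : parabolically_regular X f) :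
  exists c eps : R, [/\ 0 < c, 0 < eps &
    forall x, X x -> enorm x < eps -> f 0 + c * enorm x ^+ 2 <= f x].
Proof.
apply: contrapT => nog.
have /choice[x xP] (i : nat) : exists x, [/\ X x, enorm x < i.+1%:R^-1 &
    f x < f 0 + i.+1%:R^-1 * enorm x ^+ 2].
  apply: contrapT => nox; apply: nog; exists i.+1%:R^-1, i.+1%:R^-1.
  split; rewrite ?invr_gt0// => x Xx xi; rewrite leNgt; apply/negP => fx.
  by apply: nox; exists x.
(* The failure of growth is strict, so at the origin it would read f(0) < f(0). *)
have x0 i : x i != 0.
  apply/eqP => xi0; have [_ _] := xP i.
  by rewrite xi0 enorm_sqr to_real0 inner0l mulr0 addr0 ltxx.
have e0 i : 0 < enorm (x i) ^+ 2 by rewrite exprn_gt0 ?enorm_gt0.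
have qx i : (f (x i) - f 0) / enorm (x i) ^+ 2 < i.+1%:R^-1.
  by rewrite ltr_pdivrMr// ltrBlDl; have [] := xP i.
have [] := regular x.
- by move=> i; split=> //; have [] := xP i.
- by apply: cvg_enorm0 => i; have [] := xP i.
- exists 1 => _ [i _ <-]; apply: le_trans (ltW (qx i)) _.
  by rewrite invf_le1// ler1n.
move=> phi [u [t [w [phi_homo [Tu u0] [t0 tlim] wb [xo clw]]]]].
have [w0 [w0w w0rw]] := bounded_enorm_cluster w wb.
have T2w := clw _ w0w.
(* [h] is [f] in real coordinates, where the parabolic estimates apply. *)
have [df dg _] := fC2; set h := f \o _ in df dg.
have hE y : f y = h (to_real y) by rewrite /h/= to_realK.
have gE v : rdot (grad f 0) v = inner (gradient h 0) (to_real v).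
  by rewrite /rdot /grad of_realK to_real0.
have HE : rdot u (hess f 0 u) = inner (to_real u) (to_real u *m hessian h 0).
  by rewrite /rdot /hess of_realK to_real0.
have [||e e0'|c c0 cP] := parabolic_sequence_growth h 0 (to_real u) (to_real w0)
    (fun i => to_real (x (phi i))) (fun i => to_real (w i)) t
    df (dg 0) _ _ t0 tlim _ w0rw.
- by rewrite -gE; exact: first_order.
(* A positive infimum over the second-order tangent set makes the value at its element [w0]
   positive. *)
- rewrite -gE => gu; have := second_order _ Tu u0 gu.
  move=> /lt_le_trans/(_ (ereal_inf_lbound _)).
  by rewrite -HE -gE -lte_fin; apply; exists w0.
- move/eqoP: xo => /(_ _ e0') xe.
  apply: (@filterS _ \oo _ _ _ _ xe) => i /=.
  rewrite !ger0_norm ?sqr_ge0 ?enorm_ge0//; apply: le_trans.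
  by rewrite -to_real_parabola -to_realN -to_realD norm_to_real_le_enorm.
(* Pick a growth index with 1/(i+1) < c. As [phi] is strictly increasing, i <= phi(i), so the
   quotient at [x (phi i)] is below 1/(phi(i)+1) <= 1/(i+1) < c, contradicting growth. *)
have [i /= ic] := cP _ (near_infty_natSinv_lt (PosNum c0)).
apply/negP; rewrite -ltNge add0r -hE -(to_real0 (k := k) (n := n)) -hE -enorm_sqr.
rewrite -ltr_pdivrMr//; apply: lt_trans (qx _) _; apply: le_lt_trans ic.
rewrite lef_pV2 ?posrE// ler_nat ltnS; elim: i => // i IHi.
exact: leq_ltn_trans IHi (phi_homo _ _ (ltnSn i)).
Qed.

Theorem theorem5p3 (R : realType) (k : scalars) (n : nat)
    (X : set 'rV[scalar_field R k]_n) (f : 'rV[scalar_field R k]_n -> R)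
    (Xclosed : closed X) (X0 : X 0) (fC2 : real_C2 f)
    (first_order : forall u, tangent_cone X u -> 0 <= rdot (grad f 0) u)
    (second_order : forall u, tangent_cone X u -> u != 0 ->
       rdot (grad f 0) u = 0 ->
       (0 < ereal_inf [set (rdot u (hess f 0 u) + rdot (grad f 0) w)%:E
                        | w in tangent_set2 X u])%E)
    (regular : parabolically_regular X f) :
  strict_local_minimizer X f /\
  exists c eps : R, [/\ 0 < c, 0 < eps &
    forall x, X x -> enorm x < eps -> f 0 + c * enorm x ^+ 2 <= f x].
Proof.
have growth := quadratic_growth _ _ _ _ _ fC2 first_order second_order regular.
split=> //; split=> //; have [c [eps [c0 eps0 fX]]] := growth.
(* Strictness comes from c |x|^2 > 0 for nonzero x; the Euclidean ball is a neighbourhood of 0 in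
   K^n. *)
apply: filterS (near_enorm_lt _ eps0) => x xeps Xx x0.
apply: lt_le_trans (fX x Xx xeps).
by rewrite ltrDl mulr_gt0// exprn_gt0// enorm_gt0.
Qed.
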